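(* Let $\lambda$ be a Young diagram and fix a function $g:\mathbb Z_{\ge0}^2\to\mathbb R_{\ge 0}$. For $(i,j)\in\lambda$ define $$\psi(i,j)=\sum_{\substack{(p,q)\in\mathbb Z_{\ge0}^2\\ (i+p,\,j+q)\in\lambda}} g(p,q),\qquad \psi^\ast(i,j)=\sum_{\substack{(p,q)\in\mathbb Z_{\ge0}^2\\ (i-p,\,j-q)\in\lambda}} g(p,q).$$ Let $\Psi\langle\lambda,g\rangle=\{\psi(i,j):(i,j)\in\lambda\}$ and $\Psi^\ast\langle\lambda,g\rangle=\{\psi^\ast(i,j):(i,j)\in\lambda\}$ (as multisets). Then $\Psi\langle\lambda,g\rangle$ majorizes $\Psi^\ast\langle\lambda,g\rangle$.
   Context: Let $\lambda=(\lambda_1\ge\dots\ge\lambda_\ell>0)$ be an integer partition; its Young diagram is the set of squares $(i,j)$ with $1\le i\le\ell$, $1\le j\le\lambda_i$. Majorization: for two multisets $\mathcal A,\mathcal B$ of $n$ real numbers, let $a_1\ge\dots\ge a_n$ and $b_1\ge\dots\ge b_n$ be their elements in non-increasing order. $\mathcal A$ majorizes $\mathcal B$ if $a_1+\dots+a_k\ge b_1+\dots+b_k$ for all $1\le k<n$ and $a_1+\dots+a_n=b_1+\dots+b_n$. *)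

(* Defs.v *)
From mathcomp Require Import all_boot all_order all_algebra.
From mathcomp Require Import all_classical reals.

Set Implicit Arguments.
Unset Strict Implicit.
Unset Printing Implicit Defensive.

Import Order.TTheory GRing.Theory Num.Theory.
Local Open Scope ring_scope.
Local Open Scope classical_set_scope.

Definition is_partition (la : seq nat) : bool :=
  sorted geq la && all (fun m => 0 < m)%N la.

(* Squares (i, j) are indexed from 1, so row i has length nth 0 la i.-1. *)
Definition young (la : seq nat) : seq (nat * nat) :=
  [seq (i, j) | i <- iota 1 (size la), j <- iota 1 (nth 0%N la i.-1)].

Lemma mem_young la i j :
  ((i, j) \in young la) =
  (1 <= i <= size la)%N && (1 <= j <= nth 0%N la i.-1)%N.
Proof.
apply/allpairsPdep/idP => [[x [y [hx hy [-> ->]]]]|/andP[hi hj]].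
  by move: hx hy; rewrite !mem_iota !add1n !ltnS => -> ->.
by exists i, j; rewrite !mem_iota !add1n !ltnS.
Qed.

Lemma young_uniq la : uniq (young la).
Proof.
apply: allpairs_uniq_dep => [|x _|]; try exact: iota_uniq.
by move=> [a b] [c d] /= _ _ [-> ->].
Qed.

Section Psi.
Variables (R : realType) (la : seq nat) (g : nat * nat -> R).

(* The index sets below are finite (see the two lemmas after the section), so
   the finitely-supported sums never take their default value. *)
Definition psi (c : nat * nat) : R :=
  \sum_(d \in [set d : nat * nat | (c.1 + d.1, c.2 + d.2)%N \in young la]) g d.

(* Subtraction is truncated, which is harmless: no square of the diagram has a
   zero coordinate. *)
Definition psi_star (c : nat * nat) : R :=
  \sum_(d \in [set d : nat * nat | (c.1 - d.1, c.2 - d.2)%N \in young la]) g d.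

Definition Psi : seq R := [seq psi c | c <- young la].

Definition Psi_star : seq R := [seq psi_star c | c <- young la].

End Psi.

Lemma psi_index_finite la (c : nat * nat) :
  finite_set [set d : nat * nat | (c.1 + d.1, c.2 + d.2)%N \in young la].
Proof.
apply: (@sub_finite_set _ _
  [set` [seq (x.1 - c.1, x.2 - c.2)%N | x <- young la]]) => [[p q] /= h|];
  last exact: finite_seq.
by apply/mapP; exists (c.1 + p, c.2 + q)%N; rewrite //= !addKn.
Qed.

Lemma psi_star_index_finite la (c : nat * nat) :
  finite_set [set d : nat * nat | (c.1 - d.1, c.2 - d.2)%N \in young la].
Proof.
apply: (@sub_finite_set _ _
  [set` [seq (c.1 - x.1, c.2 - x.2)%N | x <- young la]]) => [[p q] /= h|];
  last exact: finite_seq.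
apply/mapP; exists (c.1 - p, c.2 - q)%N => //=.
move: h; rewrite mem_young => /andP[/andP[h1 _] /andP[h2 _]].
by rewrite !subKn //; apply: ltnW; rewrite -subn_gt0.
Qed.

(* Multisets of reals are represented by sequences; sorting makes the relation
   independent of the order in which the elements are listed. *)
Definition majorizes (R : realType) (A B : seq R) : Prop :=
  let a := sort >=%R A in
  let b := sort >=%R B in
  [/\ size A = size B,
      forall k, (1 <= k < size A)%N ->
        \sum_(i < k) b`_i <= \sum_(i < k) a`_i
    & \sum_(i < size A) a`_i = \sum_(i < size B) b`_i].

(* Main.v *)
(** Let [A] be a set of [k] squares of the diagram. Push the squares of [A] up
    inside their columns, then left inside their rows: this gives a set [B] of
    [k] squares of the diagram. For every [(p, q)], the number of squares of
    [A] that stay in the diagram when moved by [(-p, -q)] is at most the number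
    of squares of [B] that stay in the diagram when moved by [(p, q)]. As [B]
    does not depend on [(p, q)], weighting by [g] shows that the sum of [psi^*]
    over [A] is at most the sum of [psi] over [B]. Taking [A] to be the top
    [k] squares for [psi^*] gives the majorization inequalities; for the whole
    diagram, translation by [(p, q)] shows that the counts are equal. *)

Require Import Defs.
From mathcomp Require Import all_boot all_order all_algebra zify.
From mathcomp Require Import all_classical reals.

Import Order.TTheory GRing.Theory Num.Theory.
Local Open Scope ring_scope.

(** * Compression of subsets of an initial segment of the naturals *)

Lemma sum_ltn (N m : nat) : (\sum_(t < N) (t < m)%N = minn m N)%N.
Proof.
elim: N => [|N IH]; first by rewrite big_ord0 minn0.
by rewrite big_ord_recr /= IH; case: ltnP; lia.
Qed.

Lemma sum_interval (N p h : nat) : (\sum_(t < N) (p <= t < h)%N <= h - p)%N.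
Proof.
(* Capping [h] at [N] makes the bound tight enough for induction on [N]. *)
suff: (\sum_(t < N) (p <= t < h)%N <= minn h N - p)%N by lia.
elim: N => [|N IH]; first by rewrite big_ord0.
rewrite big_ord_recr; apply: leq_trans (leq_add IH (leqnn _)) _ => /=.
by case: (ltnP N h) => ?; case: (leqP p N) => ? /=; lia.
Qed.

Lemma downset_threshold (N : nat) (v : pred nat) :
  (forall i, v i -> (i < N)%N) -> {homo v : i j / (j <= i)%N >-> i -> j} ->
  exists2 h, (h <= N)%N & v =1 (fun i => (i < h)%N).
Proof.
move=> vN vdown.
have vE : exists h, ~~ v h by exists N; apply/negP => /vN; rewrite ltnn.
case: (ex_minnP vE) => h nvh hmin; exists h.
  by apply: hmin; apply/negP => /vN; rewrite ltnn.
move=> i; case: (ltnP i h) => hi.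
  by apply/negPn/negP => /hmin; rewrite leqNgt hi.
by apply/negP => vi; move/negP: nvh; apply; exact: vdown vi.
Qed.

(** As [v] is an initial segment with at least as many elements as [u], pushing [u] to the front
    stays inside [v]. *)
Lemma compress_sub (N : nat) (u v : pred nat) (t : nat) :
  (forall i, v i -> (i < N)%N) -> {homo v : i j / (j <= i)%N >-> i -> j} ->
  (forall i, u i -> v i) ->
  (t < \sum_(i < N) u i)%N -> v t.
Proof.
move=> vN vd uv; case: (downset_threshold _ _ vN vd) => h hN vE.
rewrite vE => /leq_trans; apply.
apply: (@leq_trans (\sum_(i < N) (i < h)))%N; last by rewrite sum_ltn geq_minl.
by apply: leq_sum => i _; case: (boolP (u i)) => // /uv; rewrite vE => ->.
Qed.

(* Both sides are compared with the smaller of [\sum u] and the number of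
   elements [>= p] of [v]; the right-hand side equals it. *)
Lemma compress_shift (N p : nat) (u v : pred nat) :
  (forall i, v i -> (i < N)%N) -> {homo v : i j / (j <= i)%N >-> i -> j} ->
  (forall i, u i -> v i) ->
  (\sum_(i < N) ((p <= i) && u i)
     <= \sum_(t < N) ((t < \sum_(i < N) u i) && v (t + p)))%N.
Proof.
move=> vN vd uv; case: (downset_threshold _ _ vN vd) => h hN vE.
set m := (\sum_(i < N) u i)%N.
rewrite [leqRHS](eq_bigr (fun t : 'I_N => nat_of_bool (t < minn m (h - p))%N)); last first.
  by move=> t _; rewrite vE; congr nat_of_bool; lia.
rewrite sum_ltn.
have le_m : (\sum_(i < N) ((p <= i) && u i) <= m)%N.
  by apply: leq_sum => i _; case: (p <= i)%N.
have le_h : (\sum_(i < N) ((p <= i) && u i) <= h - p)%N.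
  apply: leq_trans (sum_interval N p h); apply: leq_sum => i _.
  by case: (p <= i)%N => //=; case: (boolP (u i)) => // /uv; rewrite vE => ->.
lia.
Qed.

(** * Compression of a set of cells inside a two-dimensional down-set *)

Section Compression.
Variables (N : nat) (l a : nat -> nat -> bool).
Hypothesis l_box : forall i j, l i j -> (i < N)%N && (j < N)%N.
Hypothesis l_down : forall i j i' j',
  (i' <= i)%N -> (j' <= j)%N -> l i j -> l i' j'.
Hypothesis a_sub : forall i j, a i j -> l i j.

Definition col_size (j : nat) : nat := \sum_(i < N) a i j.

(* Pushing the cells of [a] to the top of their columns, then to the left of
   their rows, yields the rows of these lengths. *)
Definition row_size (t : nat) : nat := \sum_(j < N) (t < col_size j)%N.

Let col_box j i : l i j -> (i < N)%N. Proof. by case/l_box/andP. Qed.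
Let row_box i j : l i j -> (j < N)%N. Proof. by case/l_box/andP. Qed.
Let col_down j : {homo (l^~ j) : i i' / (i' <= i)%N >-> i -> i'}.
Proof. by move=> i i' le_i; apply: l_down. Qed.
Let row_down i : {homo (l i) : j j' / (j' <= j)%N >-> j -> j'}.
Proof. by move=> j j' le_j; apply: l_down. Qed.

Lemma ltn_col_size (t j : nat) : (t < col_size j)%N -> l t j.
Proof.
apply: (compress_sub N (a^~ j) (l^~ j)) => // i; first exact: col_box.
exact: a_sub.
Qed.

Lemma ltn_row_size (t s : nat) : (s < row_size t)%N -> l t s.
Proof.
apply: (compress_sub N (fun j => t < col_size j)%N (l t)) => //.
  by move=> j; apply: row_box.
by move=> j; apply: ltn_col_size.
Qed.

Lemma sum_row_size :
  (\sum_(t < N) \sum_(s < N) (s < row_size t) = \sum_(i < N) \sum_(j < N) a i j)%N.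
Proof.
(* This removes the truncation at [N] that [sum_ltn] introduces. *)
have sizeN (P : pred nat) : (\sum_(i < N) P i <= N)%N.
  rewrite -[leqRHS]muln1 -[N in leqRHS]card_ord -sum_nat_const.
  by apply: leq_sum => i _; case: (P i).
transitivity (\sum_(t < N) row_size t)%N.
  apply: eq_bigr => t _; rewrite sum_ltn.
  exact/minn_idPl/(sizeN (fun j => t < col_size j)%N).
rewrite exchange_big [RHS]exchange_big; apply: eq_bigr => j _.
by rewrite sum_ltn; apply/minn_idPl/(sizeN (a^~ j)).
Qed.

(** One-dimensional compression is used twice: in each column [j] with shift [p], then in each row
    [t] with shift [q]. *)
Lemma compression_shift (p q : nat) :
  (\sum_(i < N) \sum_(j < N) [&& p <= i, q <= j & a i j]
     <= \sum_(t < N) \sum_(s < N) ((s < row_size t) && l (t + p) (s + q)))%N.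
Proof.
rewrite exchange_big.
apply: (@leq_trans (\sum_(j < N) \sum_(t < N)
    [&& q <= j, t < col_size j & l (t + p) j])%N).
  apply: leq_sum => j _; case: (leqP q j) => _ /=; last first.
    by rewrite big1 // => i _; rewrite andbF.
  apply: (compress_shift N p (a^~ j) (l^~ j)) => // i; first exact: col_box.
  exact: a_sub.
rewrite exchange_big; apply: leq_sum => t _.
(* The second compression takes place in row [t + p] of [l]: [u] is the part of compressed row [t]
   that survives the move by [p]. It has at most [row_size t] elements. *)
pose u j := (t < col_size j)%N && l (t + p)%N j.
apply: leq_trans (compress_shift N q u (l (t + p)%N) _ _ _) _ => //.
- by move=> i; apply: row_box.
- by move=> i /andP[].
apply: leq_sum => s _; case: (l _ _); rewrite ?andbF ?andbT //.
case: ltnP => // su; case: ltnP => //; rewrite leqNgt => /negP[].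
by apply: leq_trans su _; apply: leq_sum => j _; rewrite /u; case: (t < _)%N;
  case: (l _ _).
Qed.

End Compression.

(** * From lists of squares indexed from 1 to double sums indexed from 0 *)

Definition box (N : nat) : seq (nat * nat) :=
  [seq (i, j) | i <- iota 0 N, j <- iota 0 N].

Lemma mem_box N d : (d \in box N) = (d.1 < N)%N && (d.2 < N)%N.
Proof.
case: d => i j; apply/allpairsP/andP => /= [[[x y] /= [hx hy [-> ->]]]|[hi hj]].
  by rewrite !mem_iota in hx hy.
by exists (i, j); rewrite !mem_iota.
Qed.

Lemma box_uniq N : uniq (box N).
Proof.
by apply: allpairs_uniq => [||[a b] [c d] /= _ _ [-> ->]]; rewrite ?iota_uniq.
Qed.

Lemma sum_box N (F : nat * nat -> nat) :
  (\sum_(d <- box N) F d = \sum_(i < N) \sum_(j < N) F (i : nat, j : nat))%N.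
Proof.
rewrite big_allpairs /= -[N in iota 0 N]subn0 -[iota _ _]/(index_iota 0 N).
by rewrite big_mkord; apply: eq_bigr => i _; rewrite big_mkord.
Qed.

Lemma count_box N (s : seq (nat * nat)) (P : pred (nat * nat)) :
  uniq s -> (forall c, c \in s -> (0 < c.1 <= N)%N && (0 < c.2 <= N)%N) ->
  count P s = (\sum_(i < N) \sum_(j < N)
    (((i.+1, j.+1) \in s) && P (i.+1, j.+1)))%N.
Proof.
move=> us sN.
pose S (d : nat * nat) := (d.1.+1, d.2.+1).
rewrite -(sum_box N (fun d => ((S d \in s) && P (S d) : nat))).
have /seq.permP -> : perm_eq s [seq c <- map S (box N) | c \in s].
  apply: uniq_perm => //.
    by rewrite filter_uniq // map_inj_uniq ?box_uniq // => -[a b] [c d] [-> ->].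
  move=> [i j]; rewrite mem_filter; case: (boolP (_ \in s)) => //= hs; symmetry.
  have /andP[/= hi hj] := sN _ hs.
  by apply/mapP; exists (i.-1, j.-1); rewrite ?mem_box /S /=; [lia | congr (_, _); lia].
rewrite count_filter count_map -sum1_count big_mkcond /=; apply: eq_bigr => d _.
by rewrite andbC; case: (_ && _).
Qed.

Lemma young_down la : is_partition la -> forall i j i' j',
  (0 < i' <= i)%N -> (0 < j' <= j)%N ->
  (i, j) \in young la -> (i', j') \in young la.
Proof.
move=> /andP[sla _] i j i' j' hi hj; rewrite !mem_young => /andP[hi2 hj2].
have le_nth : (nth 0 la i.-1 <= nth 0 la i'.-1)%N.
  have gt : transitive geq by move=> x y z /= h1 h2; apply: leq_trans h2 h1.
  by apply: (sorted_leq_nth gt leqnn) sla _ _ _ _ _; rewrite ?inE; lia.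
lia.
Qed.

Definition young_bound (la : seq nat) : nat := maxn (size la) (foldr maxn 0%N la).

Lemma young_box la c : c \in young la ->
  (0 < c.1 <= young_bound la)%N && (0 < c.2 <= young_bound la)%N.
Proof.
case: c => i j; rewrite mem_young /= /young_bound.
have nth_le k : (nth 0 la k <= foldr maxn 0%N la)%N.
  by elim: la k => [|m la IH] [|k] //=; [lia|have := IH k; lia].
by have := nth_le i.-1; lia.
Qed.

(** * Sums of [psi] and [psi_star] as weighted counts *)

Section Weights.
Variables (R : realType) (la : seq nat) (g : nat * nat -> R).

(** A range of displacements independent of [c] allows the sums to be exchanged. It suffices because
    [c] has positive coordinates, so a displacement staying in the diagram is less than the
    bound. *)
Lemma psiE c : c \in young la ->
  psi la g c = \sum_(d <- box (young_bound la))
    g d *+ ((c.1 + d.1, c.2 + d.2)%N \in young la).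
Proof.
case: c => i j /young_box /= hc; rewrite /psi.
under [RHS]eq_bigr do rewrite mulrb.
rewrite -big_mkcond -big_filter [RHS]fsbig_seq ?filter_uniq ?box_uniq //.
apply: eq_fsbigl; apply/funext => -[p q] /=; apply/propext.
rewrite mem_filter mem_box; split => [hd|/andP[]//]; rewrite hd /=.
by have /= := young_box _ _ hd; lia.
Qed.

Lemma psi_starE c : c \in young la ->
  psi_star la g c = \sum_(d <- box (young_bound la))
    g d *+ ((c.1 - d.1, c.2 - d.2)%N \in young la).
Proof.
case: c => i j /young_box /= hc; rewrite /psi_star.
under [RHS]eq_bigr do rewrite mulrb.
rewrite -big_mkcond -big_filter [RHS]fsbig_seq ?filter_uniq ?box_uniq //.
apply: eq_fsbigl; apply/funext => -[p q] /=; apply/propext.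
rewrite mem_filter mem_box; split => [hd|/andP[]//]; rewrite hd /=.
by have /= := young_box _ _ hd; lia.
Qed.

Lemma sum_psi (B : seq (nat * nat)) : {subset B <= young la} ->
  \sum_(c <- B) psi la g c = \sum_(d <- box (young_bound la))
    g d *+ count (fun c => (c.1 + d.1, c.2 + d.2)%N \in young la) B.
Proof.
move=> sB; rewrite (eq_big_seq _ (fun c hc => psiE c (sB c hc))) exchange_big.
by apply: eq_bigr => d _; rewrite -sum1_count [in RHS]big_mkcond -sumrMnr.
Qed.

Lemma sum_psi_star (A : seq (nat * nat)) : {subset A <= young la} ->
  \sum_(c <- A) psi_star la g c = \sum_(d <- box (young_bound la))
    g d *+ count (fun c => (c.1 - d.1, c.2 - d.2)%N \in young la) A.
Proof.
move=> sA; rewrite (eq_big_seq _ (fun c hc => psi_starE c (sA c hc))) exchange_big.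
by apply: eq_bigr => d _; rewrite -sum1_count [in RHS]big_mkcond -sumrMnr.
Qed.

End Weights.

(** * Translation and compression in a Young diagram *)

Lemma count_young_shift la (d : nat * nat) :
  count (fun c => (c.1 + d.1, c.2 + d.2)%N \in young la) (young la) =
  count (fun c => (c.1 - d.1, c.2 - d.2)%N \in young la) (young la).
Proof.
rewrite -!size_filter -(size_map (fun c => (c.1 + d.1, c.2 + d.2)%N)).
(* Translation by [d] is a bijection from the squares counted on the left to those counted on the
   right. *)
apply/perm_size/uniq_perm.
- rewrite map_inj_uniq ?filter_uniq ?young_uniq // => -[a b] [a' b'] [h h'].
  by congr (_, _); lia.
- by rewrite filter_uniq ?young_uniq.
move=> [i j]; rewrite mem_filter /=; apply/mapP/andP => [[[a b]]|[h h']].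
  by rewrite mem_filter /= => /andP[h h'] [-> ->]; rewrite !addnK.
have := young_box _ _ h => /= hd.
exists (i - d.1, j - d.2)%N; last by congr (_, _) => /=; lia.
by rewrite mem_filter h /= !subnK ?h' //; lia.
Qed.

Lemma young_compression la (A : seq (nat * nat)) :
  is_partition la -> uniq A -> {subset A <= young la} ->
  exists B : seq (nat * nat), [/\ uniq B, {subset B <= young la}, size B = size A &
    forall d : nat * nat,
      (count (fun c => (c.1 - d.1, c.2 - d.2)%N \in young la) A <=
       count (fun c => (c.1 + d.1, c.2 + d.2)%N \in young la) B)%N].
Proof.
move=> hla uA sA; set N := young_bound la.
pose l i j := (i.+1, j.+1) \in young la.
pose a i j := (i.+1, j.+1) \in A.
have l_box i j : l i j -> (i < N)%N && (j < N)%N.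
  by move=> /young_box /=; lia.
have l_down i j i' j' : (i' <= i)%N -> (j' <= j)%N -> l i j -> l i' j'.
  by move=> hi hj; apply: young_down.
have a_sub i j : a i j -> l i j by apply: sA.
pose B := [seq c <- young la | (c.2.-1 < row_size N a c.1.-1)%N].
have uB : uniq B by rewrite filter_uniq ?young_uniq.
have sB : {subset B <= young la} by move=> c; rewrite mem_filter => /andP[].
(* Filtering the diagram loses nothing, since the compressed rows lie inside it. *)
have memB t s : (t.+1, s.+1) \in B = (s < row_size N a t)%N.
  rewrite mem_filter /=; case: ltnP => //= h.
  exact: ltn_row_size l_box l_down a_sub _ _ h.
have boxA c : c \in A -> (0 < c.1 <= N)%N && (0 < c.2 <= N)%N.
  by move=> /sA/young_box.
have boxB c : c \in B -> (0 < c.1 <= N)%N && (0 < c.2 <= N)%N.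
  by move=> /sB/young_box.
exists B; split=> //.
  rewrite -!count_predT (count_box N _ _ uA boxA) (count_box N _ _ uB boxB).
  under eq_bigr do under eq_bigr do rewrite memB andbT.
  under [RHS]eq_bigr do under eq_bigr do rewrite andbT.
  exact: sum_row_size.
move=> [p q]; rewrite (count_box N _ _ uA boxA) (count_box N _ _ uB boxB) /=.
under [leqRHS]eq_bigr do under eq_bigr do rewrite memB !addSn.
apply: leq_trans (compression_shift N l a l_box l_down a_sub p q).
apply: leq_sum => i _; apply: leq_sum => j _; rewrite -/(a i j).
(* Squares have positive coordinates, so a truncated difference in the diagram forces [p <= i] and
   [q <= j]. *)
case: (a i j) => //=; case: (boolP (_ \in _)) => // /young_box /= h.
by rewrite andbT; have -> : ((p <= i) && (q <= j))%N by lia.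
Qed.

(** * Sums of the largest values *)

Section Majorization.
Variables (R : realType) (T : eqType).
Implicit Types (s B : seq T) (f : T -> R).

(** Sorting commutes with [f], so the top [k] values are attained on an explicit list of [k]
    elements. *)
Lemma sum_take_sort f s k : (k <= size s)%N ->
  \sum_(i < k) (sort >=%R (map f s))`_i =
  \sum_(x <- take k (sort (relpre f >=%R) s)) f x.
Proof.
move=> ks; rewrite sort_map -(big_map f xpredT id) map_take (big_nth 0).
rewrite size_takel ?size_map ?size_sort // big_mkord.
by apply: eq_bigr => i _; rewrite nth_take.
Qed.

(* With [v] the [k]-th largest value, [f - v] summed over any [k] elements is
   at most the sum of its positive part over [s], which the top [k] attain. *)
Lemma sum_le_top f s B : uniq s -> uniq B -> {subset B <= s} ->
  \sum_(x <- B) f x <= \sum_(i < size B) (sort >=%R (map f s))`_i.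
Proof.
move=> us uB sB; have ks := uniq_leq_size uB sB.
rewrite sum_take_sort //; set S := sort _ s; set k := size B.
case: (posnP k) => [k0|k_gt0].
  by rewrite (size0nil k0) k0 take0 !big_nil.
have sS : perm_eq S s by rewrite perm_sort.
have sizeS : size S = size s by rewrite size_sort.
have [x0 _] : exists x0, x0 \in B.
  by move: k_gt0; rewrite /k; case: (B) => // x B' _; exists x; rewrite mem_head.
pose v := f (nth x0 S k.-1).
have S_sorted : {in [pred i | (i < size S)%N] &, forall i j, (i <= j)%N ->
    f (nth x0 S j) <= f (nth x0 S i)}.
  have gt : transitive (relpre f >=%R).
    by move=> x y z /= h1 h2; apply: le_trans h2 h1.
  have gr : reflexive (relpre f >=%R) by move=> x /=.
  have St : sorted (relpre f >=%R) S.
    by apply: sort_sorted => x y /=; apply: le_total.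
  exact: (sorted_leq_nth gt gr x0 St).
pose h x := Num.max (f x - v) 0.
have h_ge0 x : 0 <= h x by rewrite le_max lexx orbT.
have sumB : \sum_(x <- B) h x <= \sum_(x <- S) h x.
  rewrite (perm_big _ sS) [leRHS](bigID (mem B)) /=.
  rewrite -[X in X + _]big_filter.
  have pB : perm_eq B [seq x <- s | x \in B].
    apply: uniq_perm => [||x]; rewrite ?filter_uniq ?mem_filter //.
    by case: (boolP (x \in B)) => // /sB ->.
  by rewrite -(perm_big _ pB) /= lerDl sumr_ge0.
(* Up to position [k.-1] the values are at least [v], afterwards at most [v], where the positive
   part vanishes. *)
have sumS : \sum_(x <- S) h x = \sum_(x <- take k S) (f x - v).
  rewrite -[in LHS](cat_take_drop k S) big_cat /= [X in _ + X]big_seq [X in _ + X]big1.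
    rewrite addr0; apply: eq_big_seq => x.
    case/(nthP x0) => i; rewrite size_takel ?sizeS // => ik <-.
    by rewrite nth_take // /h max_l // subr_ge0 S_sorted ?inE //; lia.
  move=> x; case/(nthP x0) => i; rewrite size_drop => ik <-.
  by rewrite nth_drop /h max_r // subr_le0 S_sorted ?inE //; lia.
have : \sum_(x <- B) (f x - v) <= \sum_(x <- take k S) (f x - v).
  rewrite -sumS; apply: le_trans sumB; apply: ler_sum => x _.
  by rewrite le_max lexx.
(* Both lists have [k] elements, so the copies of [v] cancel. *)
by rewrite !sumrB !big_const_seq !count_predT size_takel ?sizeS // lerD2r.
Qed.

End Majorization.

Theorem theorem4p1 (R : realType) (la : seq nat) (g : nat * nat -> R)
  (hla : is_partition la) (hg : forall d : nat * nat, 0 <= g d) :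
  majorizes (Psi la g) (Psi_star la g).
Proof.
split; first by rewrite !size_map.
  move=> k /andP[_]; rewrite size_map => /ltnW ks.
  rewrite (sum_take_sort _ _ _ _ _ ks); set A := take _ _.
  have uA : uniq A by rewrite take_uniq // sort_uniq young_uniq.
  have sA : {subset A <= young la}.
    by move=> c /mem_take; rewrite mem_sort.
  have sizeA : size A = k by rewrite size_takel // size_sort.
  have [B [uB sB sizeB leAB]] := young_compression la A hla uA sA.
  rewrite -sizeA -sizeB.
  apply: le_trans (sum_le_top _ _ _ _ _ (young_uniq la) uB sB).
  rewrite sum_psi // sum_psi_star //; apply: ler_sum => d _.
  (* Nonnegativity of [g] turns the comparison of counts into one of weighted terms. *)
  by rewrite -[leLHS]mulr_natr -[leRHS]mulr_natr ler_wpM2l ?hg // ler_nat leAB.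
rewrite !size_map !sum_take_sort ?leqnn //.
rewrite !take_oversize ?size_sort //.
have sum_sort (r : rel (nat * nat)) (f : nat * nat -> R) :
    \sum_(x <- sort r (young la)) f x = \sum_(x <- young la) f x.
  by apply: perm_big; rewrite perm_sort.
rewrite !sum_sort.
rewrite sum_psi // sum_psi_star //.
by apply: eq_bigr => d _; rewrite count_young_shift.
Qed.
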